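(* Let $1 < q < p < \infty$. Then $J_q$ does not coarse Lipschitz embed into $J_p$; that is, there is no map $f : J_q \to J_p$ which is a coarse Lipschitz embedding.
   Context: Here $\mathbb{N}=\{0,1,2,\dots\}$. For $1<p<\infty$, the James space $J_p$ is the (real) Banach space of all sequences $x:\mathbb{N}\to\mathbb{R}$ with $x(n)\to 0$ and $\|x\|_{J_p} = \sup_{p_1<\dots<p_n}\big(\sum_{i=1}^{n-1}|x(p_{i+1})-x(p_i)|^p\big)^{1/p}<\infty$, the supremum being over all finite increasing sequences $p_1<\dots<p_n$ in $\mathbb{N}$, equipped with the norm $\|\cdot\|_{J_p}$. A map $f:M\to N$ between metric spaces $(M,d)$ and $(N,\delta)$ is a coarse Lipschitz embedding if there exist $\theta, A, B>0$ such that for all $x,y\in M$: $d(x,y)\ge\theta \Rightarrow A\,d(x,y)\le \delta(f(x),f(y))\le B\,d(x,y)$. If such an $f$ exists, $M$ is said to coarse Lipschitz embed into $N$. Banach spaces are regarded as metric spaces via the norm distance. *)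

(* Defs.v *)
From HB Require Import structures.
From mathcomp Require Import all_boot all_order all_algebra.
From mathcomp Require Import all_classical all_reals all_analysis.

Set Implicit Arguments.
Unset Strict Implicit.
Unset Printing Implicit Defensive.

Import Order.TTheory GRing.Theory Num.Theory.
Import numFieldNormedType.Exports.

Local Open Scope classical_set_scope.
Local Open Scope ring_scope.

Section coarse_lipschitz.
Context {R : realType}.

Definition coarse_lipschitz_embedding (M N : metricType R) (f : M -> N) :=
  exists theta A B : R, [/\ 0 < theta, 0 < A, 0 < B &
    forall x y : M, theta <= mdist x y ->
      A * mdist x y <= mdist (f x) (f y) <= B * mdist x y].

Definition coarse_lipschitz_embeds (M N : metricType R) :=
  exists f : M -> N, coarse_lipschitz_embedding f.

End coarse_lipschitz.

(* The sum attached to the increasing sequence s of indices; it is 0 when s has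
   fewer than two terms, so allowing s = [::] does not affect the supremum. *)
Definition jvariation {R : realType} (p : R) (x : nat -> R) (s : seq nat) : R :=
  (\sum_(i < (size s).-1) `|x (nth 0%N s i.+1) - x (nth 0%N s i)| `^ p) `^ p^-1.

(* Locked so that comparing two norms never unfolds the supremum. *)
HB.lock Definition james_ereal_norm {R : realType} (p : R) (x : nat -> R) :
    \bar R :=
  ereal_sup [set (jvariation p x s)%:E | s in [set s | sorted ltn s]].
Canonical james_ereal_norm_unlockable := Unlockable james_ereal_norm.unlock.

Definition james_seq {R : realType} (p : R) : {pred nat -> R} :=
  mem [set x : nat -> R |
    x n @[n --> \oo] --> 0 /\ (james_ereal_norm p x < +oo)%E].

Section james_variations.
Context {R : realType}.
Implicit Types (p : R) (x : nat -> R) (s : seq nat).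

Lemma minkowski_sum p (p1 : 1 <= p) n (a b : nat -> R) :
  (\sum_(i < n) `|a i + b i| `^ p) `^ p^-1 <=
  (\sum_(i < n) `|a i| `^ p) `^ p^-1 + (\sum_(i < n) `|b i| `^ p) `^ p^-1.
Proof.
have p0 : 0 < p by rewrite (lt_le_trans _ p1).
pose t (c : nat -> R) i := if (i < n)%N then c i else 0.
have tE c : Lnorm counting p%:E (EFin \o t c) =
    ((\sum_(i < n) `|c i| `^ p) `^ p^-1)%:E.
  rewrite Lnorm_counting// (nneseries_split 0 n)//; last first.
    by move=> k _; rewrite poweR_ge0.
  rewrite add0n eseries0 ?adde0; last first.
    move=> i ni _; rewrite /t /= ltnNge ni /= normr0 powR0//.
    by rewrite gt_eqF.
  rewrite big_mkord -poweR_EFin -sumEFin; congr (_ `^ _)%E.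
  by apply: eq_bigr => i _; rewrite /t /= ltn_ord.
have tD : t (fun i => a i + b i) = t a \+ t b.
  by apply/funext => i; rewrite /t /=; case: ifP => // _; rewrite addr0.
have mt (c : nat -> R) : measurable_fun [set: nat] c by [].
have := minkowski_EFin counting (mt (t a)) (mt (t b)) p1.
by rewrite -tD !tE -EFinD lee_fin.
Qed.

Lemma jvariation_ge0 p x s : 0 <= jvariation p x s.
Proof. exact: powR_ge0. Qed.

Lemma jvariationD p x y s : 1 <= p ->
  jvariation p (x \+ y) s <= jvariation p x s + jvariation p y s.
Proof.
move=> p1; pose incr (z : nat -> R) i := z (nth 0%N s i.+1) - z (nth 0%N s i).
apply: le_trans (minkowski_sum p1 _ (incr x) (incr y)).
rewrite le_eqVlt; apply/orP; left; apply/eqP.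
congr (_ `^ _); apply: eq_bigr => i _; congr (`|_| `^ _).
by rewrite /incr /= opprD addrACA.
Qed.

Lemma jvariationZ p (c : R) x s : 0 < p ->
  jvariation p (fun n => c * x n) s = `|c| * jvariation p x s.
Proof.
move=> p0; rewrite /jvariation.
under eq_bigr do rewrite -mulrBr normrM powRM//.
rewrite -mulr_sumr powRM ?powR_ge0//; last first.
  by apply: sumr_ge0 => i _; exact: powR_ge0.
by rewrite -powRrM mulfV ?gt_eqF// powRr1.
Qed.

Lemma jvariation_pair p x m n : 0 < p ->
  jvariation p x [:: m; n] = `|x n - x m|.
Proof.
move=> p0; rewrite /jvariation /= big_ord_recl big_ord0 addr0 /=.
by rewrite -powRrM mulfV ?gt_eqF// powRr1.
Qed.

Lemma jvariation_bounded p x s (d : R) : 0 < p -> 0 <= d ->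
  (forall i, (i < size s)%N -> `|x (nth 0%N s i)| <= d) ->
  jvariation p x s <= (size s).-1%:R `^ p^-1 * (2 * d).
Proof.
move=> p0 d0 xd; have d20 : 0 <= 2 * d by rewrite mulr_ge0.
have -> : 2 * d = ((2 * d) `^ p) `^ p^-1.
  by rewrite -powRrM mulfV ?gt_eqF// powRr1.
rewrite -powRM ?powR_ge0 ?ler0n//.
rewrite ge0_ler_powR ?nnegrE ?invr_ge0 ?(ltW p0)//.
- by apply: sumr_ge0 => i _; exact: powR_ge0.
- by rewrite mulr_ge0 ?powR_ge0.
have -> : (size s).-1%:R * (2 * d) `^ p = \sum_(i < (size s).-1) (2 * d) `^ p.
  by rewrite sumr_const card_ord mulr_natl.
apply: ler_sum => i _; rewrite ge0_ler_powR ?nnegrE ?(ltW p0)//.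
have is1 : (i.+1 < size s)%N by rewrite -ltn_predRL.
rewrite (le_trans (ler_normB _ _))// mulr_natl mulr2n lerD// xd//.
exact: ltnW.
Qed.

Lemma jvariation_le p x s : sorted ltn s ->
  ((jvariation p x s)%:E <= james_ereal_norm p x)%E.
Proof. by move=> ss; rewrite unlock; apply: ereal_sup_ubound; exists s. Qed.

Lemma james_ereal_norm_ge0 p x : (0 <= james_ereal_norm p x)%E.
Proof.
apply: (@le_trans _ _ (jvariation p x [::])%:E).
  by rewrite lee_fin jvariation_ge0.
exact: jvariation_le.
Qed.

Lemma james_ereal_norm_leP p x (c : \bar R) :
  (forall s, sorted ltn s -> ((jvariation p x s)%:E <= c)%E) <->
  (james_ereal_norm p x <= c)%E.
Proof.
split=> [H|H s ss]; last by apply: le_trans H; exact: jvariation_le.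
by rewrite unlock; apply: ge_ereal_sup => _ [s ss <-]; exact: H.
Qed.

Lemma james_ereal_normD p x y : 1 <= p ->
  (james_ereal_norm p (x \+ y)%R <=
   james_ereal_norm p x + james_ereal_norm p y)%E.
Proof.
move=> p1; apply/james_ereal_norm_leP => s ss.
rewrite (@le_trans _ _ (jvariation p x s + jvariation p y s)%:E)//.
  by rewrite lee_fin jvariationD.
by rewrite EFinD leeD// jvariation_le.
Qed.

Lemma james_ereal_normZ p (c : R) x : 0 < p ->
  (james_ereal_norm p (fun n => (c * x n)%R) = `|c|%:E * james_ereal_norm p x)%E.
Proof.
move=> p0.
have le d y :
    (james_ereal_norm p (fun n => (d * y n)%R) <= `|d|%:E * james_ereal_norm p y)%E.
  apply/james_ereal_norm_leP => s ss.
  by rewrite jvariationZ// EFinM lee_pmul ?lee_fin ?jvariation_ge0 ?jvariation_le.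
apply/eqP; rewrite eq_le le /=.
have [->|c0] := eqVneq c 0.
  by rewrite normr0 mul0e james_ereal_norm_ge0.
rewrite muleC -lee_pdivlMr ?normr_gt0// muleC.
have {1}-> : x = (fun n => c^-1 * (c * x n)).
  by apply/funext => n; rewrite mulKf.
by rewrite (le_trans (le _ _))// normfV.
Qed.

Lemma james_seqP p x : x \in james_seq p <->
  x n @[n --> \oo] --> 0 /\ (james_ereal_norm p x < +oo)%E.
Proof. by split=> [/set_mem|/mem_set]. Qed.

Lemma james_seq_cvg p x : x \in james_seq p -> x n @[n --> \oo] --> 0.
Proof. by move/james_seqP => -[]. Qed.

Lemma james_fin_num p x : (james_ereal_norm p x < +oo)%E ->
  james_ereal_norm p x \is a fin_num.
Proof. by rewrite ge0_fin_numE// james_ereal_norm_ge0. Qed.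

Lemma james_seq_fin p x : x \in james_seq p ->
  james_ereal_norm p x \is a fin_num.
Proof. by move/james_seqP => -[_ /james_fin_num]. Qed.

Lemma james_submod_closed p : 1 < p ->
  submod_closed (james_seq p : {pred nat -> R^o}).
Proof.
move=> p1; have p0 : 0 < p by rewrite (lt_trans _ p1).
split=> [|a x y /james_seqP[x0 xf] /james_seqP[y0 yf]]; apply/james_seqP; split.
- exact: cvg_cst.
- have -> : (0 : nat -> R^o) = (fun=> 0 * 0).
    by apply/funext => n; rewrite mul0r.
  by rewrite (james_ereal_normZ 0 (fun=> 0))// normr0 mul0e.
- rewrite -[X in _ --> X](addr0 0) -[X in _ --> X + _](mulr0 a).
  by apply: cvgD => //; exact: cvgMr.
- apply: (@le_lt_trans _ _
    (james_ereal_norm p (fun n => (a * x n)%R) + james_ereal_norm p y)%E).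
    exact: james_ereal_normD (ltW p1).
  rewrite james_ereal_normZ//; apply: lte_add_pinfty yf.
  by rewrite -(fineK (james_fin_num xf)) -EFinM ltry.
Qed.

End james_variations.

Record james (R : realType) (p : R) (p1 : 1 < p) := James {
  james_val :> nat -> R;
  james_valP : james_val \in james_seq p }.

Section james_space.
Context {R : realType} {p : R} {p1 : 1 < p}.
Local Notation james := (james p1).
Implicit Types x y : james.

Let p0 : 0 < p. Proof. exact: lt_trans p1. Qed.

HB.instance Definition _ := [isSub for @james_val R p p1].
HB.instance Definition _ := [Choice of james by <:].
HB.instance Definition _ := GRing.isSubmodClosed.Build R (nat -> R^o)
  (james_seq p : {pred nat -> R^o}) (james_submod_closed p1).
HB.instance Definition _ := [SubChoice_isSubLmodule of james by <:].

Definition james_norm x : R := fine (james_ereal_norm p x).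

Lemma james_normE x : (james_norm x)%:E = james_ereal_norm p x.
Proof. by rewrite fineK// james_seq_fin// james_valP. Qed.

Lemma james_norm_ge0 x : 0 <= james_norm x.
Proof. by rewrite -lee_fin james_normE james_ereal_norm_ge0. Qed.

Lemma james_norm_leP x (c : R) :
  (forall s, sorted ltn s -> jvariation p x s <= c) <-> james_norm x <= c.
Proof.
rewrite -lee_fin james_normE -james_ereal_norm_leP.
by split=> h s ss; have := h s ss; rewrite lee_fin.
Qed.

Lemma james_valD x y : x + y = x \+ y :> (nat -> R).
Proof. by []. Qed.

Lemma james_valZ (c : R) x : c *: x = (fun n => c * x n) :> (nat -> R).
Proof. by []. Qed.

Lemma ler_james_normD x y : james_norm (x + y) <= james_norm x + james_norm y.
Proof.
rewrite -lee_fin EFinD !james_normE james_valD.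
exact: james_ereal_normD (ltW p1).
Qed.

Lemma james_normZ (c : R) x : james_norm (c *: x) = `|c| * james_norm x.
Proof.
apply: EFin_inj; rewrite EFinM !james_normE james_valZ.
exact: james_ereal_normZ p0.
Qed.

Lemma james_cvg0 x : x n @[n --> \oo] --> 0.
Proof. exact: james_seq_cvg (james_valP x). Qed.

Lemma james_norm_coord x n : `|x n| <= james_norm x.
Proof.
apply/ler_addgt0Pr => e e0.
have /cvgr0Pnorm_le /(_ _ e0) [N _ Nx] := @james_cvg0 x.
pose m := maxn N n.+1.
rewrite (_ : x n = - (x m - x n) + x m); last by rewrite opprB subrK.
rewrite (le_trans (ler_normD _ _))// normrN lerD//; last first.
  by apply: Nx; rewrite /= leq_maxl.
rewrite -(jvariation_pair _ _ _ p0).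
by have /james_norm_leP := lexx (james_norm x); apply; rewrite /= leq_maxr.
Qed.

Lemma james_norm0_eq0 x : james_norm x = 0 -> x = 0.
Proof.
move=> x0; apply/val_inj/funext => n /=; apply/eqP.
by rewrite -normr_le0 -x0 james_norm_coord.
Qed.

HB.instance Definition _ := Lmodule_isNormed.Build R james
  ler_james_normD james_normZ james_norm0_eq0.

Let james_mdist x y : R := `|y - x|.

Let james_mdist_ge0 x y : 0 <= james_mdist x y.
Proof. exact: normr_ge0. Qed.

Let james_mdist_eq0 x y : james_mdist x y = 0 -> x = y.
Proof. by move/normr0_eq0/eqP; rewrite subr_eq0 => /eqP. Qed.

Let james_ballE x (d : R) : ball x d = [set y | james_mdist x y < d].
Proof. by apply/seteqP; split=> y; rewrite -ball_normE /= distrC. Qed.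

HB.instance Definition _ := PseudoMetric_isMetric.Build R james
  james_mdist_ge0 james_mdist_eq0 james_ballE.

Lemma james_mdistE x y : mdist x y = james_norm (x - y).
Proof. by rewrite -[mdist x y]/(`|y - x|) distrC. Qed.

Lemma james_complete (F : set_system james) :
  ProperFilter F -> cauchy F -> cvg F.
Proof.
move=> FF Fc; pose small (A : set james) (e : R) :=
  forall x z, A x -> A z -> james_norm (x - z) <= e.
have Fe (e : R) : 0 < e -> exists2 A, F A & small A e.
  move=> e0; have e20 : 0 < e / 2 by rewrite divr_gt0.
  have [w Fw] := (cauchyP _).1 Fc _ e20.
  exists (ball w (e / 2)) => // x z; rewrite -!ball_normE /= => wx wz.
  rewrite -[james_norm _]/(`|x - z|) [leRHS]splitr.
  by rewrite (le_trans (ler_distD w _ _))// lerD ?ltW// distrC.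
pose ev n (x : james) : R := x n.
have coord n : cvg (ev n @ F).
  apply: R_complete; apply/cauchyP => e e0.
  have [|A FA Ae] := Fe (e / 2); first by rewrite divr_gt0.
  have [w Aw] := filter_ex FA.
  exists (w n); suff: F [set z : james | ball (w n) e (z n)] by [].
  apply: filterS FA => z Az; rewrite /ball /=.
  apply: (@le_lt_trans _ _ (e / 2)).
    exact: le_trans (james_norm_coord (w - z) n) (Ae _ _ Aw Az).
  by rewrite ltr_pdivrMr// ltr_pMr// ltr1n.
pose y n : R := lim (ev n @ F).
have yF n (d : R) : 0 < d -> F [set z : james | `|z n - y n| <= d].
  move=> d0; have /cvgrPdist_le /(_ _ d0) : ev n @ F --> y n by exact: coord.
  by apply: filterS => z; rewrite distrC.
have cle A e x n : F A -> A x -> small A e -> `|x n - y n| <= e.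
  move=> FA Ax Ae; apply/ler_addgt0Pr => d d0.
  have [z [Az zy]] := filter_ex (filterI FA (yF n _ d0)).
  apply: le_trans (ler_distD (z n) _ _) _; apply: lerD zy.
  exact: le_trans (james_norm_coord (x - z) n) (Ae _ _ Ax Az).
have vle A e x s : F A -> A x -> small A e -> sorted ltn s ->
    jvariation p (x \- y) s <= e.
  move=> FA Ax Ae ss; apply/ler_addgt0Pr => d d0.
  pose c : R := (size s).-1%:R `^ p^-1.
  have c0 : 0 <= c by exact: powR_ge0.
  have c1 : 0 < c + 1 by rewrite ltr_wpDl.
  pose r := d / (c + 1) / 2.
  have r0 : 0 < r by rewrite !divr_gt0.
  have Fz : F [set z : james | forall i : 'I_(size s),
      `|z (nth 0%N s i) - y (nth 0%N s i)| <= r].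
    by apply: filter_forall => i; exact: yF.
  have [z [Az zy]] := filter_ex (filterI FA Fz).
  have -> : x \- y = james_val (x - z) \+ (z \- y).
    by apply/funext => i /=; rewrite addrA subrK.
  apply: le_trans (jvariationD _ _ _ (ltW p1)) _; apply: lerD.
    exact: (james_norm_leP (x - z) e).2 (Ae _ _ Ax Az) s ss.
  have zyr i : (i < size s)%N -> `|(z \- y) (nth 0%N s i)| <= r.
    by move=> si; exact: (zy (Ordinal si)).
  apply: le_trans (jvariation_bounded p0 (ltW r0) zyr) _.
  rewrite -/c /r (mulrC 2) divfK// mulrA ler_pdivrMr// mulrC.
  by rewrite ler_wpM2l ?ltW// ltrDl.
have yJ : y \in james_seq p.
  apply/james_seqP; split.
    apply/cvgr0Pnorm_le => e e0; have e20 : 0 < e / 2 by rewrite divr_gt0.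
    have [A FA Ae] := Fe _ e20.
    have [x Ax] := filter_ex FA.
    have /cvgr0Pnorm_le /(_ _ e20) := @james_cvg0 x.
    apply: filterS => n xn; rewrite -[y n](subrK (x n)) [leRHS]splitr.
    apply: le_trans (ler_normD _ _) _; apply: lerD xn.
    by rewrite distrC; exact: cle FA Ax Ae.
  have [A FA Ae] := Fe _ ltr01.
  have [x Ax] := filter_ex FA.
  apply: (@le_lt_trans _ _ (1 + james_norm x)%:E); last exact: ltry.
  apply/james_ereal_norm_leP => s ss.
  have -> : y = (fun n => -1 * (x \- y) n) \+ x.
    by apply/funext => n /=; rewrite mulN1r opprB subrK.
  rewrite lee_fin; apply: le_trans (jvariationD _ _ _ (ltW p1)) _.
  rewrite jvariationZ// normrN1 mul1r; apply: lerD.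
    exact: vle FA Ax Ae ss.
  exact: (james_norm_leP x _).2 (lexx _) s ss.
apply/cvg_ex; exists (James p1 yJ); apply/cvgrPdist_le => e e0.
have [A FA Ae] := Fe _ e0.
apply: (filterS _ FA) => x Ax; rewrite distrC.
by apply/james_norm_leP => s ss; exact: vle FA Ax Ae ss.
Qed.

HB.instance Definition _ := Uniform_isComplete.Build james james_complete.

End james_space.

(* Main.v *)
(* Compare, on k-tuples of integers, the map h(s) = theta * (sum of the unit
   vectors e_n, n in s) into J_q with the composite g = f o h into J_p.
   Changing one coordinate moves h by a bounded amount at least theta (if at
   all), so it moves g by at most a constant L.  For interlaced tuples
   n_1 < m_1 < n_2 < m_2 < ... the distance between h(n) and h(m) is at least
   2 theta k^(1/q), whereas some interlaced pair has |g(n) - g(m)| of order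
   L k^(1/p); letting k tend to infinity gives a contradiction as q < p.

   For the upper bound, let F_j(n_1..n_j) be the iterated pointwise limit of
   g(n_1..n_k) in the last k - j coordinates along a nonprincipal ultrafilter.
   The pair is chosen coordinate by coordinate: passing from j to j + 1 adds to
   F_j(n) - F_j(m) a sequence of variation at most 2L that is almost 0 on the
   initial interval carrying almost all the variation of F_j(n) - F_j(m), so
   that p-th powers of variations add up to a multiple of L^p per step.
   Since J_p is not reflexive, F_j(n) need not vanish at infinity; the
   coordinates are also chosen so that F_j(n) and F_j(m) have almost the same
   limit at infinity, for all j at once. *)
Require Import Defs.
From mathcomp Require Import all_boot all_order all_algebra.
From mathcomp Require Import all_classical all_reals all_analysis.
From mathcomp Require Import ring lra.

Set Implicit Arguments.
Unset Strict Implicit.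
Unset Printing Implicit Defensive.

Import Order.TTheory GRing.Theory Num.Theory.
Import numFieldNormedType.Exports.

Local Open Scope classical_set_scope.
Local Open Scope ring_scope.

(** * Increasing index sequences cut at a bound *)

Lemma sorted_ltn_filter_cat b (s : seq nat) : sorted ltn s ->
  s = [seq t <- s | (t < b)%N] ++ [seq t <- s | (b <= t)%N].
Proof.
elim: s => [//|a s IH] /= ps; have ss := path_sorted ps.
case: (ltnP a b) => [ab|ba]; first by rewrite cat_cons -IH.
have sb t : t \in s -> (b <= t)%N.
  move: ps; rewrite (path_sortedE ltn_trans) => /andP[/allP h _] /h.
  by move/ltnW; exact: leq_trans.
have -> : [seq t <- s | (t < b)%N] = [::].
  apply/eqP; rewrite -size_eq0 size_filter -leqn0 leqNgt -has_count.
  by apply/hasPn => t /sb; rewrite -leqNgt.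
by rewrite (all_filterP _)//; apply/allP.
Qed.

Lemma sorted_ltn_size_le b (s : seq nat) :
  sorted ltn s -> all (fun t => (t < b)%N) s -> (size s <= b)%N.
Proof.
move=> ss /allP sb; rewrite -(size_iota 0 b); apply: uniq_leq_size.
  exact: sorted_uniq ltn_trans ltnn _ ss.
by move=> t /sb; rewrite mem_iota add0n.
Qed.

Lemma sorted_ltn_cat_bound b (s1 s2 : seq nat) :
  sorted ltn s1 -> sorted ltn s2 -> all (fun t => (t < b)%N) s1 ->
  all (fun t => (b <= t)%N) s2 -> sorted ltn (s1 ++ s2).
Proof.
move=> ss1 ss2 /allP h1 /allP h2.
rewrite sorted_pairwise; last exact: ltn_trans.
rewrite pairwise_cat -!sorted_pairwise ?ss1 ?ss2 ?andbT; try exact: ltn_trans.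
by apply/allrelP => a c /h1 ab /h2; exact: leq_trans.
Qed.

(** * Powers and p-variations *)

Section powR_facts.
Context {R : realType}.
Implicit Types (p X c : R).

Lemma powRVK p X : 0 < p -> 0 <= X -> (X `^ p^-1) `^ p = X.
Proof. by move=> p0 X0; rewrite -powRrM mulVf ?gt_eqF// powRr1. Qed.

Lemma powRKV p X : 0 < p -> 0 <= X -> (X `^ p) `^ p^-1 = X.
Proof. by move=> p0 X0; rewrite -powRrM mulfV ?gt_eqF// powRr1. Qed.

Lemma powR_upper_slack p X c : 0 < p -> 0 <= X -> 0 < c ->
  exists2 e, 0 < e & (X + e) `^ p <= X `^ p + c.
Proof.
move=> p0 X0 c0; pose Y := (X `^ p + c) `^ p^-1.
have Xc : 0 <= X `^ p + c by rewrite addr_ge0 ?powR_ge0 ?ltW.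
exists (Y - X).
  rewrite subr_gt0 -{1}(powRKV p0 X0) gt0_ltr_powR ?invr_gt0 ?nnegrE ?powR_ge0//.
  by rewrite ltrDl.
by rewrite addrC subrK powRVK.
Qed.

Lemma powR_unbounded (d C : R) : 0 < d -> exists2 k : nat, (0 < k)%N & C < k%:R `^ d.
Proof.
move=> d0; have [C0|C0] := ltrP C 0.
  by exists 1%N => //; rewrite (lt_le_trans C0) ?powR_ge0.
exists (Num.truncn (C `^ d^-1)).+1 => //.
rewrite -{1}(powRVK d0 C0) gt0_ltr_powR ?nnegrE ?powR_ge0 ?ler0n//.
exact: truncnS_gt.
Qed.

End powR_facts.

Section jsum.
Context {R : realType}.
Implicit Types (p c : R) (x y : nat -> R) (s : seq nat).

Definition jsum p x s : R :=
  \sum_(i < (size s).-1) `|x (nth 0%N s i.+1) - x (nth 0%N s i)| `^ p.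

Lemma jsum_ge0 p x s : 0 <= jsum p x s.
Proof. by apply: sumr_ge0 => i _; exact: powR_ge0. Qed.

Lemma jvariation_powR p x s : 0 < p -> jvariation p x s `^ p = jsum p x s.
Proof. by move=> p0; rewrite powRVK ?jsum_ge0. Qed.

Lemma jvariation_leE p x s c : 0 < p -> 0 <= c ->
  (jvariation p x s <= c) = (jsum p x s <= c `^ p).
Proof.
move=> p0 c0; rewrite -jvariation_powR//; apply/idP/idP => h.
  by rewrite ge0_ler_powR ?nnegrE ?jvariation_ge0 ?(ltW p0).
rewrite -(powRKV p0 c0) -(powRKV p0 (jvariation_ge0 p x s)).
by rewrite ge0_ler_powR ?nnegrE ?powR_ge0// invr_ge0 ltW.
Qed.

Lemma jsum_nil p x : jsum p x [::] = 0.
Proof. by rewrite /jsum big_ord0. Qed.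

Lemma jsum_seq1 p x a : jsum p x [:: a] = 0.
Proof. by rewrite /jsum big_ord0. Qed.

Lemma jsum_cons2 p x a b s :
  jsum p x [:: a, b & s] = `|x b - x a| `^ p + jsum p x (b :: s).
Proof. by rewrite /jsum /= big_ord_recl. Qed.

Lemma jsum_cons_ge p x a s : jsum p x s <= jsum p x (a :: s).
Proof.
case: s => [|b s]; first by rewrite jsum_nil jsum_seq1.
by rewrite jsum_cons2 lerDr powR_ge0.
Qed.

Lemma jsum_cat_ge p x s1 s2 :
  jsum p x s1 + jsum p x s2 <= jsum p x (s1 ++ s2).
Proof.
elim: s1 => [|a [|b s1] IH]; first by rewrite jsum_nil add0r.
  by rewrite jsum_seq1 add0r jsum_cons_ge.
by rewrite !cat_cons !jsum_cons2 -addrA lerD2l -cat_cons.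
Qed.

(** Only one increment crosses the junction, and [c] pays for it; if [s1] or [s2] is empty there is
    none. *)
Lemma jsum_cat_le p x s1 s2 c : 0 <= c ->
  (forall a b, a \in s1 -> b \in s2 -> `|x b - x a| `^ p <= c) ->
  jsum p x (s1 ++ s2) <= jsum p x s1 + c + jsum p x s2.
Proof.
move=> c0; elim: s1 => [|a [|b s1] IH] h.
- by rewrite jsum_nil add0r lerDr.
- case: s2 h {IH} => [|b s2] h.
    by rewrite !jsum_seq1 jsum_nil add0r addr0.
  rewrite cat_cons cat0s jsum_cons2 jsum_seq1 add0r lerD2r.
  by apply: h; rewrite inE eqxx.
- rewrite !cat_cons !jsum_cons2 -!addrA lerD2l addrA.
  by apply: IH => u v us vs; apply: h => //; rewrite inE us orbT.
Qed.

Lemma jsum_ext p x y s : {in s, x =1 y} -> jsum p x s = jsum p y s.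
Proof.
move=> xy; apply: eq_bigr => i _.
have si : (i.+1 < size s)%N by rewrite -ltn_predRL.
by rewrite !xy ?mem_nth// ltnW.
Qed.

Lemma jsum0 p s : p != 0 -> jsum p (fun=> 0) s = 0.
Proof. by move=> p0; apply: big1 => i _; rewrite subrr normr0 powR0. Qed.

(** Otherwise every tail carries a sum above [e]; concatenating [N] such sequences, each beyond the
    previous ones, gives at least [N * e] by superadditivity, which exceeds [c] for large [N]. *)
Lemma jsum_tail p x c : (forall s, sorted ltn s -> jsum p x s <= c) ->
  forall e, 0 < e -> exists b, forall s, sorted ltn s ->
    all (fun t => (b <= t)%N) s -> jsum p x s <= e.
Proof.
move=> xc e e0; apply/not_existsP => H.
have H' b : exists s, [/\ sorted ltn s, all (fun t => (b <= t)%N) s & e < jsum p x s].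
  move/existsNP: (H b) => [s /not_implyP[ss /not_implyP[sb /negP]]].
  by rewrite -ltNge => ?; exists s.
have [N] : exists N : nat, c < N%:R * e.
  exists (Num.truncn (c / e)).+1; rewrite -ltr_pdivrMr//; exact: truncnS_gt.
suff [s ss sN] : exists2 s, sorted ltn s & N%:R * e <= jsum p x s.
  by rewrite ltNge (le_trans sN)// xc.
elim: N => [|N [s ss sN]]; first by exists [::] => //; rewrite mul0r jsum_ge0.
have [s' [ss' sb es']] := H' (\max_(t <- s) t).+1.
exists (s ++ s').
  apply: sorted_ltn_cat_bound ss ss' _ sb.
  by apply/allP => t ts; rewrite ltnS; apply: leq_bigmax_seq.
apply: le_trans (jsum_cat_ge _ _ _ _).
by rewrite mulrSr mulrDl mul1r lerD// ltW.
Qed.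

Lemma jvariation_small p n e : 0 < p -> 0 < e -> exists2 d, 0 < d &
  forall x s, (size s <= n)%N -> (forall t, t \in s -> `|x t| <= d) ->
  jvariation p x s <= e.
Proof.
move=> p0 e0; pose c : R := n%:R `^ p^-1.
have c0 : 0 <= c by exact: powR_ge0.
have c1 : 0 < c + 1 by rewrite ltr_wpDl.
exists (e / (c + 1) / 2); first by rewrite !divr_gt0.
move=> x s sn xd.
have d0 : 0 <= e / (c + 1) / 2 by rewrite !divr_ge0 ?ltW.
apply: le_trans (jvariation_bounded p0 d0 _) _.
  by move=> i si; apply: xd; exact: mem_nth.
rewrite (mulrC 2) divfK// mulrA ler_pdivrMr// mulrC ler_pM2l//.
apply: (@le_trans _ _ c); last by rewrite lerDl.
apply: ge0_ler_powR; rewrite ?nnegrE ?ler0n// ?ler_nat ?invr_ge0.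
  exact: ltW.
exact: leq_trans (leq_pred _) sn.
Qed.

End jsum.

(** * Iterated limits along an ultrafilter *)

Section ultrafilter_limits.
Context {R : realType} (U : set_system nat) {UU : UltraFilter U}.
Implicit Types (x y : nat -> R) (l c : R).

(** By compactness of [[-c, c]] the image of [U] has a cluster point, and an ultrafilter converges
    to its cluster points. *)
Lemma ultra_bounded_cvg x c : (forall m, `|x m| <= c) -> cvg (x m @[m --> U]).
Proof.
move=> xc; have [|l [_ clu]] := @segment_compact R (- c) c (x @ U) _.
  by apply: nearW => m; rewrite /= in_itv /= -ler_norml.
apply/cvg_ex; exists l; apply/cvgrPdist_le => e e0.
have [//|nU] := in_ultra_setVsetC [set m | `|l - x m| <= e] UU.
have [z [/= h1]] := clu [set z | ~ `|l - z| <= e] _ nU (nbhsx_ballx l _ e0).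
by rewrite -ball_normE /= => /ltW.
Qed.

Lemma cvg_norm_le x l c : x m @[m --> U] --> l -> (forall m, `|x m| <= c) ->
  `|l| <= c.
Proof.
move=> /cvg_norm xl xc; rewrite -(cvg_lim _ xl)//.
by apply: limr_le; [apply/cvg_ex; eexists; exact: xl|exact: nearW].
Qed.

Lemma cvg_dist_le x y a b c : x m @[m --> U] --> a -> y m @[m --> U] --> b ->
  (forall m, `|x m - y m| <= c) -> `|a - b| <= c.
Proof. by move=> xa yb; apply: cvg_norm_le; exact: cvgB. Qed.

(** The variation along a fixed [s] involves finitely many coordinates, on which some [f m] is
    uniformly close to [y]. *)
Lemma cvg_jvariation_le p (f : nat -> nat -> R) y (s : seq nat) c : 1 <= p ->
  (forall t, f m t @[m --> U] --> y t) ->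
  (forall m, jvariation p (f m) s <= c) -> jvariation p y s <= c.
Proof.
move=> p1 fy fc; have p0 : 0 < p by apply: lt_le_trans p1.
apply/ler_addgt0Pr => e e0.
have [d d0 small] := jvariation_small (size s) p0 e0.
have Um : U [set m | forall i : 'I_(size s),
    `|y (nth 0%N s i) - f m (nth 0%N s i)| <= d].
  by apply: filter_forall => i; exact: cvgr_dist_le (fy _) _ d0.
have [m mP] := filter_ex Um.
have -> : y = f m \+ (y \- f m) by apply/funext => t /=; rewrite addrC subrK.
apply: le_trans (jvariationD _ _ _ p1) _; rewrite lerD// small// => t.
by move=> /(nthP 0%N)[i si <-]; exact: (mP (Ordinal si)).
Qed.

End ultrafilter_limits.

Section iterated_limits.
Context {R : realType} (U : set_system nat) {UU : UltraFilter U}.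
Context (p L : R) (p1 : 1 <= p).
Implicit Types (phi : seq nat -> R) (f : seq nat -> nat -> R) (s : seq nat).

(** The [L]-Lipschitz condition for the Hamming distance on tuples of equal length. *)
Definition hamming_lip phi :=
  forall s1 a b s2, `|phi (s1 ++ a :: s2) - phi (s1 ++ b :: s2)| <= L.

Definition last_lim phi s : R := lim (phi (rcons s m) @[m --> U]).

Lemma last_lim_cvg phi s : hamming_lip phi ->
  phi (rcons s m) @[m --> U] --> last_lim phi s.
Proof.
move=> lip; apply: (@ultra_bounded_cvg _ _ _ _ (L + `|phi (rcons s 0%N)|)) => m.
rewrite -[phi (rcons s m)](subrK (phi (rcons s 0%N))).
by rewrite (le_trans (ler_normD _ _))// lerD// -!cats1.
Qed.

Lemma hamming_lip_last_lim phi : hamming_lip phi -> hamming_lip (last_lim phi).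
Proof.
move=> lip s1 a b s2.
apply: cvg_dist_le (last_lim_cvg lip) (last_lim_cvg lip) _ => m.
by rewrite !rcons_cat !rcons_cons.
Qed.

Lemma last_lim_dist phi s n : hamming_lip phi ->
  `|phi (rcons s n) - last_lim phi s| <= L.
Proof.
move=> lip; apply: cvg_dist_le (cvg_cst _) (last_lim_cvg lip) _ => m.
by rewrite -!cats1.
Qed.

(* The values of f are sequences; they need not vanish at infinity, since
   iterated pointwise limits of elements of the James space do not. *)
Record james_lip f : Prop := JamesLip {
  lip_jvariation : forall s1 a b s2 l, sorted ltn l ->
    jvariation p (f (s1 ++ a :: s2) \- f (s1 ++ b :: s2)) l <= L;
  lip_coord : forall t, hamming_lip (f ^~ t);
  lip_bounded : forall s, exists c, forall t, `|f s t| <= c }.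

Definition last_limf f s t : R := last_lim (f ^~ t) s.

(** The value of [f s] at infinity, taken along [U] so that boundedness ensures its existence. *)
Definition tail_lim f s : R := lim (f s t @[t --> U]).

Lemma james_lip_last_limf f : james_lip f -> james_lip (last_limf f).
Proof.
case=> lJ lC lB; split=> [s1 a b s2 l sl|t|s]; last 2 first.
- exact: hamming_lip_last_lim.
- have [c fc] := lB (rcons s 0%N); exists (L + c) => t.
  apply: (cvg_norm_le (last_lim_cvg (lC t))) => m.
  rewrite -[f _ t](subrK (f (rcons s 0%N) t)).
  by rewrite (le_trans (ler_normD _ _))// lerD// -!cats1 lC.
apply: (@cvg_jvariation_le _ U _ _
  (fun m => f (rcons (s1 ++ a :: s2) m) \- f (rcons (s1 ++ b :: s2) m))) => //.
  by move=> t; apply: cvgB; exact: last_lim_cvg.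
by move=> m; rewrite !rcons_cat !rcons_cons lJ.
Qed.

Lemma last_limf_jvariation f s n l : james_lip f -> sorted ltn l ->
  jvariation p (f (rcons s n) \- last_limf f s) l <= L.
Proof.
case=> lJ lC _ sl; apply: (@cvg_jvariation_le _ U _ _
  (fun m => f (rcons s n) \- f (rcons s m))) => //.
  by move=> t; apply: cvgB; [exact: cvg_cst|exact: last_lim_cvg].
by move=> m; rewrite -!cats1 lJ.
Qed.

Lemma last_limf_near f s (b : nat) (e : R) : james_lip f -> 0 < e ->
  U [set n | forall t, (t < b)%N -> `|f (rcons s n) t - last_limf f s t| <= e].
Proof.
case=> _ lC _ e0.
have : U [set n | forall t : 'I_b, `|last_limf f s t - f (rcons s n) t| <= e].
  by apply: filter_forall => t; exact: cvgr_dist_le (last_lim_cvg (lC t)) _ e0.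
by apply: filterS => n h t tb; rewrite distrC; exact: (h (Ordinal tb)).
Qed.

Lemma tail_lim_cvg f s : james_lip f -> f s t @[t --> U] --> tail_lim f s.
Proof. by case=> _ _ /(_ s)[c]; exact: ultra_bounded_cvg. Qed.

Lemma hamming_lip_tail_lim f : james_lip f -> hamming_lip (tail_lim f).
Proof.
move=> lf s1 a b s2.
apply: cvg_dist_le (tail_lim_cvg lf) (tail_lim_cvg lf) _ => t.
exact: lip_coord lf t _ _ _ _.
Qed.

End iterated_limits.

(** * Interlaced pairs *)

Definition interleave (r : seq (nat * nat)) : seq nat :=
  flatten [seq [:: a.1; a.2] | a <- r].

Lemma interleave_rcons r n m :
  interleave (rcons r (n, m)) = interleave r ++ [:: n; m].
Proof. by rewrite /interleave map_rcons flatten_rcons. Qed.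

(** * Inductive choice of interlaced pairs *)

Section concentration.
Context {R : realType} (p L : R).
Hypotheses (p1 : 1 < p) (L0 : 0 < L).

Let p0 : 0 < p. Proof. exact: lt_trans p1. Qed.
Let D : R := (10 * L) `^ p.

(** Cut [l] at [b]. The left part has variation at most [X + e], the right part at most [L + 2 * L],
    and the crossing increment is at most twice [5 * L]; [D] bounds the [p]-th powers of the last
    two. *)
Lemma jsum_add_block (x u : nat -> R) (b : nat) (X e : R) : 0 <= X -> 0 <= e ->
  (forall l, sorted ltn l -> jvariation p x l <= X) ->
  (forall l, sorted ltn l -> all (fun t => (b <= t)%N) l ->
    jvariation p x l <= L) ->
  (forall l, sorted ltn l -> jvariation p u l <= 2 * L) ->
  (forall l, sorted ltn l -> all (fun t => (t < b)%N) l ->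
    jvariation p u l <= e) ->
  (forall t, `|x t + u t| <= 5 * L) ->
  forall l, sorted ltn l -> jsum p (x \+ u) l <= (X + e) `^ p + 2 * D.
Proof.
move=> X0 e0 xX xL uL ue xu l sl.
have L10 : 0 <= 10 * L by rewrite mulr_ge0 ?ltW.
have D0 : 0 <= D by exact: powR_ge0.
rewrite (sorted_ltn_filter_cat b sl).
have s1 := sorted_filter ltn_trans (fun t => (t < b)%N) sl.
have s2 := sorted_filter ltn_trans (fun t => (b <= t)%N) sl.
have a1 := filter_all (fun t => (t < b)%N) l.
have a2 := filter_all (fun t => (b <= t)%N) l.
apply: le_trans (jsum_cat_le D0 _) _.
  move=> c d _ _; apply: ge0_ler_powR; rewrite ?nnegrE ?(ltW p0)//=.
  by have := ler_normB (x d + u d) (x c + u c); have := xu c; have := xu d; lra.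
have h1 : jsum p (x \+ u) [seq t <- l | (t < b)%N] <= (X + e) `^ p.
  rewrite -jvariation_leE ?addr_ge0// (le_trans (jvariationD _ _ _ (ltW p1)))//.
  by rewrite lerD ?xX ?ue.
have h2 : jsum p (x \+ u) [seq t <- l | (b <= t)%N] <= D.
  rewrite -jvariation_leE// (le_trans (jvariationD _ _ _ (ltW p1)))//.
  apply: le_trans (lerD (xL _ s2 a2) (uL _ s2)) _; lra.
lra.
Qed.

Context (U : set_system nat) {UU : UltraFilter U} (Uoo : \oo `<=` U).
Context (k : nat) (F : nat -> seq nat -> nat -> R).
Hypothesis (F_lip : forall i, (i <= k)%N -> james_lip p L (F i)).
Hypothesis (F_lim : forall i, (i < k)%N -> F i = last_limf U (F i.+1)).

Let gap j (r : seq (nat * nat)) t := F j (unzip1 r) t - F j (unzip2 r) t.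
(** The limit at infinity comes before the limits in the last [i - j] coordinates. These limits need
    not commute, so [G i j] may differ from [G j j], and all [i] have to be followed. *)
Let G i j := iter (i - j) (last_lim U) (tail_lim U (F i)).

(* In good_tail, the limit at infinity of F_i for every later stage i is tested
   through its iterated limit G i j in the coordinates not chosen yet. *)
Record good_pairs j (e : R) (r : seq (nat * nat)) : Prop := GoodPairs {
  good_size : size r = j;
  good_sorted : sorted ltn (interleave r);
  good_tail : forall i, (j <= i <= k)%N ->
    `|G i j (unzip1 r) - G i j (unzip2 r)| <= e;
  good_sup : forall t, `|gap j r t| <= 4 * L + e;
  good_jsum : forall l, sorted ltn l -> jsum p (gap j r) l <= j%:R * (3 * D) }.

(** Far out the variation is at most [d], so the value at [t] is within [d] of the value at a later
    [t'] close to the limit at infinity. That limit is at most [e] by [good_tail] with [i = j], and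
    each tuple adds an error [d / 2]. *)
Lemma good_pairs_tail j e d r : (j <= k)%N -> good_pairs j e r -> 0 < d ->
  exists b, (forall l, sorted ltn l -> all (fun t => (b <= t)%N) l ->
      jvariation p (gap j r) l <= d) /\
    forall t, (b <= t)%N -> `|gap j r t| <= e + d * 2.
Proof.
move=> jk good d0.
have [b bP] := jsum_tail (good_jsum good) (powR_gt0 p d0).
have bP' l : sorted ltn l -> all (fun t => (b <= t)%N) l ->
    jvariation p (gap j r) l <= d.
  by move=> sl al; rewrite jvariation_leE ?(ltW d0)// bP.
exists b; split=> // t bt.
have cv s : F j s t @[t --> U] --> tail_lim U (F j) s by exact: tail_lim_cvg (F_lip jk).
have d20 : 0 < d / 2 by rewrite divr_gt0.
have near1 s : U [set t | `|tail_lim U (F j) s - F j s t| <= d / 2].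
  by have /cvgrPdist_le := cv s; exact.
have [t' [[t'1 t'2] tt']] := filter_ex (filterI
  (filterI (near1 (unzip1 r)) (near1 (unzip2 r))) (Uoo (nbhs_infty_gt t))).
have := bP' [:: t; t']; rewrite jvariation_pair//= !andbT bt.
rewrite (leq_trans bt (ltnW tt')) tt' => /(_ isT isT).
have := good_tail good (i := j); rewrite leqnn jk /G subnn /= => /(_ isT).
move: t'1 t'2; rewrite /gap /= !ler_norml.
by move=> /andP[? ?] /andP[? ?] /andP[? ?] /andP[? ?]; apply/andP; split; lra.
Qed.

(** The requirements amount to finitely many sets of [U], which have a common element; [Uoo] allows
    it to exceed [N]. *)
Lemma last_lim_near j s d b (N : nat) : (j < k)%N -> 0 < d ->
  exists n, [/\ (N < n)%N,
    forall i, (j < i <= k)%N -> `|G i j.+1 (rcons s n) - G i j s| <= d &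
    forall t, (t < b)%N -> `|F j.+1 (rcons s n) t - F j s t| <= d].
Proof.
move=> jk d0; have lipG i j' : (i <= k)%N -> hamming_lip L (G i j').
  move=> ik; rewrite /G; elim: (i - j')%N => [|m IH] /=.
    exact: hamming_lip_tail_lim (F_lip ik).
  exact: hamming_lip_last_lim.
have near1 : U [set n | forall i : 'I_k.+1, (j < i)%N ->
    `|G i j s - G i j.+1 (rcons s n)| <= d].
  apply: filter_forall => i; have ik : (i <= k)%N by rewrite -ltnS.
  have [ji|_] := ltnP j i; last by apply: nearW.
  have cG : G i j.+1 (rcons s m) @[m --> U] --> last_lim U (G i j.+1) s.
    exact: last_lim_cvg (lipG i j.+1 ik).
  have /cvgrPdist_le/(_ _ d0) := cG.
  rewrite (_ : last_lim _ _ _ = G i j s); first by apply: filterS.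
  by rewrite /G -iterS subnSK.
have near2 : U [set n | forall t, (t < b)%N ->
    `|F j.+1 (rcons s n) t - last_limf U (F j.+1) s t| <= d].
  exact: last_limf_near (F_lip jk) d0.
have [n [[n1 n2] Nn]] :=
  filter_ex (filterI (filterI near1 near2) (Uoo (nbhs_infty_gt N))).
exists n; split=> // [i /andP[ji ik]|t tb].
  by rewrite distrC; apply: (n1 (Ordinal (ik : (i < k.+1)%N))).
by rewrite (F_lim jk); exact: n2.
Qed.

Lemma good_pairs_step j : (j < k)%N ->
  (forall e, 0 < e -> exists r, good_pairs j e r) ->
  forall e, 0 < e -> exists r, good_pairs j.+1 e r.
Proof.
move=> jk IH e e0; have D0 : 0 < D by rewrite powR_gt0// mulr_gt0.
have jD0 : 0 <= j%:R * (3 * D) by rewrite !mulr_ge0 ?ler0n ?(ltW D0).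
(* Enlarging the variation by [h] costs at most one [D] in [p]-th powers; with the [2 * D] of
   [jsum_add_block], a step costs [3 * D]. *)
have [h h0 hP] := powR_upper_slack p0 (powR_ge0 (j%:R * (3 * D)) p^-1) D0.
rewrite powRVK// in hP.
(* The errors in the tail and sup bounds below add up to at most [3 * d]. *)
have [d [d0 de dL dh]] : exists d, [/\ 0 < d, 5 * d <= e, 5 * d <= L & d <= h].
  exists (Num.min (Num.min (e / 5) (L / 5)) h); split.
  - by rewrite !lt_min h0 !divr_gt0.
  - by rewrite mulrC -ler_pdivlMr ?ltr0n// !ge_min lexx.
  - by rewrite mulrC -ler_pdivlMr ?ltr0n// !ge_min lexx orbT.
  - by rewrite ge_min lexx orbT.
have [r good] := IH d d0.
have [b [bvar bsup]] := good_pairs_tail (ltnW jk) good d0.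
(* An increasing sequence below [b] has at most [b] terms, so a sup bound [d'] there keeps the
   variation of [u] below [h]. Since [u] is a difference of two increments, each is made at most
   [d' / 2]. *)
have [d' d'0 small] := jvariation_small b p0 h0.
pose d2 := Num.min d (d' / 2).
have d20 : 0 < d2 by rewrite lt_min d0 divr_gt0.
have d2d : d2 <= d by rewrite ge_min lexx.
have d2d' : d2 <= d' / 2 by rewrite ge_min lexx orbT.
pose N := \max_(t <- interleave r) t.
have [n [Nn Gn Fn]] := last_lim_near (unzip1 r) b N jk d20.
have [m [nm Gm Fm]] := last_lim_near (unzip2 r) b n jk d20.
pose v1 := F j.+1 (rcons (unzip1 r) n) \- F j (unzip1 r).
pose v2 := F j.+1 (rcons (unzip2 r) m) \- F j (unzip2 r).
pose u := v1 \+ (fun t => -1 * v2 t).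
have gapE : gap j.+1 (rcons r (n, m)) = gap j r \+ u.
  apply/funext => t; rewrite /gap /u /v1 /v2 /unzip1 /unzip2 !map_rcons /=.
  by ring.
have var s i l : sorted ltn l -> jvariation p (F j.+1 (rcons s i) \- F j s) l <= L.
  move=> sl; rewrite (F_lim jk).
  exact: (last_limf_jvariation (ltW p1) _ _ (F_lip jk) sl).
have coord s i t : `|F j.+1 (rcons s i) t - F j s t| <= L.
  by rewrite (F_lim jk); exact: (last_lim_dist s i (lip_coord (F_lip jk) t)).
have ule t c : `|v1 t| <= c -> `|v2 t| <= c -> `|u t| <= c * 2.
  move=> h1 h2; rewrite /u /= mulN1r (le_trans (ler_normB _ _))//.
  by rewrite mulr_natr mulr2n lerD.
have usup t : `|u t| <= L * 2 by apply: ule; exact: coord.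
have ub t : (t < b)%N -> `|u t| <= d2 * 2.
  by move=> tb; apply: ule; [exact: Fn|exact: Fm].
have sup t : `|gap j r t + u t| <= 4 * L + e /\ `|gap j r t + u t| <= 5 * L.
  have := ler_normD (gap j r t) (u t); have [tb|bt] := ltnP t b.
    by have := ub _ tb; have := good_sup good t; lra.
  by have := usup t; have := bsup _ bt; lra.
exists (rcons r (n, m)); split.
- by rewrite size_rcons (good_size good).
- rewrite interleave_rcons; apply: (@sorted_ltn_cat_bound N.+1).
  + exact: good_sorted good.
  + by rewrite /= nm.
  + by apply/allP => t ti; rewrite ltnS; apply: leq_bigmax_seq.
  + by rewrite /= Nn (ltn_trans Nn nm).
- move=> i /andP[ji ik]; have jik : (j < i <= k)%N by rewrite ji.
  rewrite /unzip1 /unzip2 !map_rcons -/(unzip1 r) -/(unzip2 r).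
  have := Gn _ jik; have := Gm _ jik.
  have := good_tail good (i := i); rewrite (ltnW ji) ik => /(_ isT).
  move: (G i j _) (G i j _) (G i j.+1 _) (G i j.+1 _) => x2 x1 x3 x4 h1 h2 h3.
  have := ler_normD (x1 - x2) ((x3 - x1) - (x4 - x2)).
  have := ler_normB (x3 - x1) (x4 - x2).
  rewrite (_ : x1 - x2 + _ = x3 - x4); last by ring.
  by lra.
- by move=> t; rewrite gapE; case: (sup t).
- move=> l sl; rewrite gapE.
  apply: le_trans (_ : (j%:R * (3 * D) + D) + 2 * D <= _); last first.
    by rewrite mulrSr; lra.
  apply: le_trans (lerD hP (lexx _)).
  apply: (@jsum_add_block _ _ b) => //.
  + exact: powR_ge0.
  + exact: ltW.
  + by move=> l' sl'; rewrite jvariation_leE ?powR_ge0// powRVK// (good_jsum good).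
  + by move=> l' sl' al'; rewrite (le_trans (bvar _ sl' al'))//; lra.
  + move=> l' sl'; apply: le_trans (jvariationD _ _ _ (ltW p1)) _.
    rewrite jvariationZ// normrN1 mul1r.
    apply: le_trans (lerD (var _ n _ sl') (var _ m _ sl')) _; lra.
  + move=> l' sl' al'; apply: small; first exact: sorted_ltn_size_le al'.
    by move=> t tl; have := ub t (allP al' _ tl); lra.
  + by move=> t; case: (sup t).
Qed.

Lemma good_pairs_exists j e : (j <= k)%N -> 0 < e -> exists r, good_pairs j e r.
Proof.
move=> + e0; elim: j e e0 => [|j IH] e e0 jk; last first.
  by apply: good_pairs_step => // d d0; apply: IH => //; exact: ltnW.
have gap0 : gap 0 [::] = fun=> 0 by apply/funext => t; rewrite /gap subrr.
exists [::]; split=> // [i _|t|l _].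
- by rewrite subrr normr0 ltW.
- by rewrite gap0 normr0 addr_ge0 ?mulr_ge0 ?ltW.
- by rewrite gap0 jsum0 ?gt_eqF// mul0r.
Qed.

End concentration.

(** Each of the [k] coordinates costs [3 * D] in [p]-th powers, hence the order [k^(1/p)]. *)
Lemma james_concentration (R : realType) (p : R) (p1 : 1 < p) (L : R) (k : nat)
    (f : seq nat -> james p1) : 0 < L ->
  (forall s1 a b s2, james_norm (f (s1 ++ a :: s2) - f (s1 ++ b :: s2)) <= L) ->
  exists r, [/\ size r = k, sorted ltn (interleave r) &
    james_norm (f (unzip1 r) - f (unzip2 r)) <=
      (k%:R * (3 * (10 * L) `^ p)) `^ p^-1].
Proof.
move=> L0 fL; have p0 : 0 < p := lt_trans ltr01 p1.
have [U [UU Uoo]] := ultraFilterLemma eventually_filter.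
pose F i := iter (k - i) (last_limf U) (fun s => f s : nat -> R).
have F_lip i : (i <= k)%N -> james_lip p L (F i).
  move=> _; rewrite /F; elim: (k - i)%N => [|m IH] /=; last first.
    exact: james_lip_last_limf (ltW p1) _ IH.
  split=> [s1 a b s2 l sl|t s1 a b s2|s].
  - exact: (james_norm_leP _ _).2 (fL s1 a b s2) l sl.
  - exact: le_trans (james_norm_coord _ t) (fL s1 a b s2).
  - by exists (james_norm (f s)) => t; exact: james_norm_coord.
have F_lim i : (i < k)%N -> F i = last_limf U (F i.+1).
  by move=> ik; rewrite /F -iterS subnSK.
(* At stage [k] no limit is left and [F k] is [f] itself; any positive accuracy would serve. *)
have [r good] := good_pairs_exists p1 L0 Uoo F_lip F_lim (leqnn k) ltr01.
exists r; split; [exact: good_size good|exact: good_sorted good|].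
apply/james_norm_leP => l sl; rewrite jvariation_leE ?powR_ge0// powRVK//.
  have := good_jsum good sl; rewrite /F subnn /=; exact.
by rewrite !mulr_ge0 ?ler0n ?powR_ge0.
Qed.

(** * Sums of unit vectors *)

Section unit_vectors.
Context {R : realType} {q : R} (q1 : 1 < q).

Let q0 : 0 < q. Proof. exact: lt_trans q1. Qed.

(** Only the increments into and out of [n] can be nonzero, and each is at most 1. *)
Lemma jsum_unit (n : nat) (s : seq nat) : sorted ltn s ->
  jsum q (fun t => (t == n)%:R : R) s <= 2.
Proof.
move=> ss; pose x t : R := (t == n)%:R.
have us : uniq s by exact: sorted_uniq ltn_trans ltnn _ ss.
have zero s' : n \notin s' -> jsum q x s' = 0.
  move=> ns; rewrite (@jsum_ext _ _ _ (fun=> 0)) ?jsum0 ?gt_eqF// => t ts.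
  by rewrite /x; case: eqP => // tn; rewrite -tn ts in ns.
have jump a b : `|x b - x a| `^ q <= 1.
  have <- : 1 `^ q = 1 :> R by rewrite powR1.
  apply: ge0_ler_powR; rewrite ?nnegrE ?(ltW q0)//.
  rewrite /x; case: (_ == _); case: (_ == _);
    by rewrite ?subrr ?subr0 ?sub0r ?normrN ?normr1 ?normr0 ?ler01.
have [ns|ns] := boolP (n \in s); last by rewrite zero.
case/splitPr: ns us => s1 s2; rewrite cat_uniq /= => /and3P[_].
rewrite negb_or => /andP[n1 _] /andP[n2 _].
apply: le_trans (jsum_cat_le ler01 (fun a b _ _ => jump a b)) _.
rewrite -cat1s (zero s1)// add0r.
have := jsum_cat_le (s1 := [:: n]) (s2 := s2) ler01 (fun a b _ _ => jump a b).
rewrite jsum_seq1 (zero s2)//; lra.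
Qed.

Lemma james_seq_unit (n : nat) : (fun t => (t == n)%:R : R) \in james_seq q.
Proof.
apply/james_seqP; split.
  apply/cvgrPdist_le => e e0; exists n.+1 => // t /= nt.
  by rewrite gtn_eqF// subrr normr0 ltW.
apply: (@le_lt_trans _ _ (2 `^ q^-1)%:E); last exact: ltry.
apply/james_ereal_norm_leP => s ss.
by rewrite lee_fin jvariation_leE ?powR_ge0// powRVK// jsum_unit.
Qed.

Definition james_unit n : james q1 := James q1 (james_seq_unit n).

Lemma james_norm_unit n : james_norm (james_unit n) <= 2.
Proof.
apply/james_norm_leP => s ss; rewrite jvariation_leE//.
by apply: le_trans (jsum_unit n ss) _; apply: le1r_powR (ltW q1); rewrite ler1n.
Qed.

Definition james_hamming (s : seq nat) : james q1 := \sum_(n <- s) james_unit n.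

Lemma james_hammingE s t : james_hamming s t = (count_mem t s)%:R.
Proof.
rewrite /james_hamming; elim: s => [|n s IH]; first by rewrite big_nil.
by rewrite big_cons james_valD /= IH -natrD /= eq_sym.
Qed.

Lemma james_hamming_dist s1 a b s2 :
  james_hamming (s1 ++ a :: s2) - james_hamming (s1 ++ b :: s2) =
  james_unit a - james_unit b.
Proof.
rewrite /james_hamming !big_cat !big_cons /= opprD addrACA subrr add0r.
by rewrite opprD addrACA subrr addr0.
Qed.

(** Only the increments inside the pairs are kept; those between consecutive pairs are dropped. *)
Lemma jsum_interleave_ge (x : nat -> R) r :
  \sum_(a <- r) `|x a.2 - x a.1| `^ q <= jsum q x (interleave r).
Proof.
elim: r => [|a r IH]; first by rewrite big_nil jsum_ge0.
rewrite big_cons (_ : interleave _ = [:: a.1, a.2 & interleave r])//.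
by rewrite jsum_cons2 lerD2l (le_trans IH)// jsum_cons_ge.
Qed.

(** Along [interleave r] the difference alternates between 1 and -1, so each pair contributes
    [2^q]. *)
Lemma james_hamming_interleave r : sorted ltn (interleave r) ->
  (size r)%:R `^ q^-1 * 2 <=
    james_norm (james_hamming (unzip1 r) - james_hamming (unzip2 r)).
Proof.
move=> sr; set x := _ - _.
(* All entries are distinct, so no unit vectors cancel or repeat. *)
have us : uniq (unzip1 r ++ unzip2 r).
  have <- : perm_eq (interleave r) (unzip1 r ++ unzip2 r) ->
      uniq (interleave r) = uniq (unzip1 r ++ unzip2 r) by exact: perm_uniq.
    exact: sorted_uniq ltn_trans ltnn _ sr.
  elim: {sr x} r => //= a r IH.
  rewrite /interleave /= -/(interleave r) perm_cons perm_sym.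
  by rewrite -cat1s perm_catCA /= perm_cons perm_sym.
have xE t : x t = (count_mem t (unzip1 r))%:R - (count_mem t (unzip2 r))%:R.
  by rewrite -!james_hammingE /x -scaleN1r james_valD james_valZ /= mulN1r.
have := (james_norm_leP x _).2 (lexx _) _ sr.
apply: le_trans; rewrite -(powRKV q0 (ler0n R 2)) -powRM ?powR_ge0 ?ler0n//.
apply: ge0_ler_powR;
  rewrite ?nnegrE ?invr_ge0 ?(ltW q0) ?mulr_ge0 ?powR_ge0 ?ler0n ?jsum_ge0//.
apply: le_trans (jsum_interleave_ge x r).
rewrite mulr_natl -[X in _ *+ X]sum1_size -sumrMnr big_seq [leRHS]big_seq.
apply: ler_sum => a ar; rewrite mulr1n.
have nr : a.1 \in unzip1 r by exact: map_f.
have mr : a.2 \in unzip2 r by exact: map_f.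
move: us; rewrite cat_uniq => /and3P[u1 /hasPn dis u2].
rewrite !xE !count_uniq_mem// nr mr (negPf (dis _ mr)).
have -> : (a.1 \in unzip2 r) = false by apply/negP => /dis; rewrite /= nr.
by rewrite subr0 sub0r -opprD normrN -natrD normr_nat.
Qed.

End unit_vectors.

(** * Comparison of the rates [k^(1/q)] and [k^(1/p)] *)

Theorem corollary3p6 (R : realType) (p q : R) (hq : 1 < q) (hqp : q < p)
    (hp : 1 < p) :
  ~ coarse_lipschitz_embeds (james hq) (james hp).
Proof.
case=> f [theta [A [B [theta0 A0 B0 fP]]]].
have q0 : 0 < q := lt_trans ltr01 hq.
have p0 : 0 < p := lt_trans ltr01 hp.
pose h s : james hq := theta *: james_hamming hq s.
(* Changing one coordinate moves [h] by at most [theta * 4], as unit vectors have norm at most 2. *)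
pose L := B * (theta * 4).
have L0 : 0 < L by rewrite !mulr_gt0.
have fh s1 a b s2 : james_norm (f (h (s1 ++ a :: s2)) - f (h (s1 ++ b :: s2))) <= L.
  (* For [a = b] the distance is 0, below the threshold [theta], so [fP] gives nothing; otherwise
     coordinate [a] shows that the distance is at least [theta]. *)
  have [->|ab] := eqVneq a b.
    rewrite subrr (_ : james_norm 0 = 0) ?(ltW L0)//.
    by rewrite -(scale0r (0 : james hp)) james_normZ normr0 mul0r.
  have hE : mdist (h (s1 ++ a :: s2)) (h (s1 ++ b :: s2)) =
      theta * james_norm (james_unit hq a - james_unit hq b).
    by rewrite james_mdistE -scalerBr james_hamming_dist james_normZ gtr0_norm.
  have ge1 : 1 <= james_norm (james_unit hq a - james_unit hq b).
    apply: le_trans (james_norm_coord _ a).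
    rewrite -scaleN1r james_valD james_valZ /= eqxx (negPf ab).
    by rewrite mulr0 addr0 normr1.
  have le4 : james_norm (james_unit hq a - james_unit hq b) <= 4.
    apply: le_trans (ler_james_normD _ _) _.
    rewrite -scaleN1r james_normZ normrN1 mul1r.
    by have := james_norm_unit hq a; have := james_norm_unit hq b; lra.
  have /fP : theta <= mdist (h (s1 ++ a :: s2)) (h (s1 ++ b :: s2)).
    by rewrite hE ler_pMr.
  case/andP=> _; rewrite -james_mdistE => /le_trans; apply.
  by rewrite hE /L !ler_pM2l.
(* Once [k^(1/q - 1/p)] exceeds [C], the lower bound [2 * A * theta * k^(1/q)] is greater than the
   upper bound from [james_concentration]. *)
pose C := (3 * (10 * L) `^ p) `^ p^-1 / (A * theta).
have d0 : 0 < q^-1 - p^-1 by rewrite subr_gt0 ltf_pV2 ?posrE.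
have [k k0 kC] := powR_unbounded C d0.
have [r [rk sr]] := @james_concentration R p hp L k (f \o h) L0 fh.
rewrite /= -james_mdistE leNgt => /negP; apply.
(* This puts the interlaced pair at distance at least [theta], so that the lower bound of [fP]
   applies. *)
have k1 : 1 <= k%:R `^ q^-1 :> R.
  apply: le_trans (_ : k%:R `^ 0 <= _); first by rewrite powRr0.
  by apply: ler_powR; rewrite ?ler1n ?invr_ge0 ?(ltW q0).
have hr : theta * (k%:R `^ q^-1 * 2) <= mdist (h (unzip1 r)) (h (unzip2 r)).
  rewrite james_mdistE -scalerBr james_normZ gtr0_norm// ler_pM2l// -rk.
  exact: james_hamming_interleave.
have /fP/andP[+ _] : theta <= mdist (h (unzip1 r)) (h (unzip2 r)).
  by apply: le_trans hr; rewrite ler_pMr//; lra.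
apply: lt_le_trans.
apply: lt_le_trans (_ : A * (theta * (k%:R `^ q^-1 * 2)) <= _); last first.
  by rewrite ler_pM2l.
rewrite powRM ?ler0n ?mulr_ge0 ?powR_ge0//.
have kE : k%:R `^ q^-1 = k%:R `^ p^-1 * k%:R `^ (q^-1 - p^-1) :> R.
  rewrite -powRD; last by rewrite pnatr_eq0 -lt0n k0 implybT.
  by rewrite addrC subrK.
have kp0 : 0 < k%:R `^ p^-1 :> R by rewrite powR_gt0 ?ltr0n.
move: kC; rewrite /C ltr_pdivrMr ?mulr_gt0// kE => kC.
set K := _ `^ p^-1 in kC *; set P := k%:R `^ p^-1 in kp0 *.
set E := k%:R `^ _ in kC *.
have E0 : 0 < P * (E * (A * theta)).
  by rewrite !mulr_gt0 ?powR_gt0 ?ltr0n.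
have : P * K < P * (E * (A * theta)) by rewrite ltr_pM2l.
have -> : A * (theta * (P * E * 2)) = P * (E * (A * theta)) * 2 by ring.
lra.
Qed.
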